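(* Assume the image axiom stated in the context. Let $V$ be a locally $U$-small type with an equivalence $\sup:\mathcal{P}_U V\simeq V$, and for $x:V$ and $y\equiv\sup(A,f)$ define $x\in y:=\sum_{a:A}f\,a=x$. Then $(V,\in)$ has finite propositional tupling: for every finite type $A$ and every $v:A\to V$ there is $\{v\}:V$ such that for all $z:V$, $(z\in\{v\})\simeq \exists_{a:A}\,v\,a=z$.
   Context: Homotopy type theory with a univalent universe $U$ inside a larger univalent universe $\mathrm{Type}$; $U$ contains the standard finite types $\mathrm{Fin}\,n$, and a finite type is one (merely) equivalent to some $\mathrm{Fin}\,n$. $\exists$ is the propositionally truncated $\Sigma$. A type is essentially $U$-small if equivalent to a type in $U$; locally $U$-small if each of its identity types is essentially $U$-small. $A\hookrightarrow B$ denotes embeddings and $A\twoheadrightarrow B$ surjections. $\mathcal{P}_U X:=\sum_{A:U}(A\hookrightarrow X)$. Image axiom: for every $A:U$, locally $U$-small $X:\mathrm{Type}$ and $f:A\to X$ there are $\mathrm{image}\,f:U$, $\mathrm{surj}\,f:A\twoheadrightarrow\mathrm{image}\,f$ and $\mathrm{incl}\,f:\mathrm{image}\,f\hookrightarrow X$ with $\mathrm{incl}\,f(\mathrm{surj}\,f\,a)\equiv f\,a$. *)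

(* Defs.v *)
(* Rocq's own types cannot stand for the types of homotopy type theory:
   univalence contradicts proof irrelevance for Stdlib's [eq], and the
   impredicative [Prop] makes all identity types small.  A hypothesis of
   univalence on Rocq types would make the theorem vacuous, and local smallness
   would say nothing.  So the type theory is given here as an object, by its raw
   terms, judgemental equality and typing rules, and a theorem of homotopy type
   theory is a closed type that has a closed inhabitant.

   The theory is that of the HoTT Book, with constants and defining equations:
   universes "a la Russell", cumulative and typically ambiguous (universe levels
   occur in [Univ] only; every type former and eliminator exists at all levels).
   U is [Univ 0] and Type is [Univ 1].  Higher universes only serve to type
   statements that quantify over Type; univalence is assumed for U and Type
   alone, and the natural numbers are not assumed to lie in U. *)

From Stdlib Require Import List Arith.
Import ListNotations.

Inductive const : Set :=
| cEmpty | cEmptyInd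
| cUnit | cStar | cUnitInd
| cSum | cInl | cInr | cSumInd
| cNat | cZero | cSucc | cNatInd
| cSig | cPair | cSigInd
| cId | cRefl | cJ
| cTrunc | cTr | cSquash | cTruncRec
| cUnivalenceU | cUnivalenceType
| cImage | cSurj | cSurjIsSurj | cIncl | cInclIsEmb.

Inductive term : Set :=
| Var (n : nat)
| Univ (i : nat)
| Pi (A B : term)
| Lam (A b : term)
| App (f a : term)
| Con (c : const).

Fixpoint lift (k c : nat) (t : term) : term :=
  match t with
  | Var n => if n <? c then Var n else Var (k + n)
  | Univ i => Univ i
  | Pi A B => Pi (lift k c A) (lift k (S c) B)
  | Lam A b => Lam (lift k c A) (lift k (S c) b)
  | App f a => App (lift k c f) (lift k c a)
  | Con x => Con x
  end.

Fixpoint subst (u : term) (c : nat) (t : term) : term :=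
  match t with
  | Var n => if n <? c then Var n
             else if n =? c then lift c 0 u else Var (pred n)
  | Univ i => Univ i
  | Pi A B => Pi (subst u c A) (subst u (S c) B)
  | Lam A b => Lam (subst u c A) (subst u (S c) b)
  | App f a => App (subst u c f) (subst u c a)
  | Con x => Con x
  end.

Definition apps (c : const) (l : list term) : term := fold_left App l (Con c).

(* As in Rocq's kernel, judgemental equality is a relation on raw terms.
   [conv_incl_surj] is the judgemental equation of the image axiom. *)

Inductive conv : term -> term -> Prop :=
| conv_refl t : conv t t
| conv_sym t u : conv t u -> conv u t
| conv_trans t u v : conv t u -> conv u v -> conv t v
| conv_Pi A A' B B' : conv A A' -> conv B B' -> conv (Pi A B) (Pi A' B')
| conv_Lam A A' b b' : conv A A' -> conv b b' -> conv (Lam A b) (Lam A' b')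
| conv_App f f' a a' : conv f f' -> conv a a' -> conv (App f a) (App f' a')
| conv_beta A b a : conv (App (Lam A b) a) (subst a 0 b)
| conv_eta A f : conv (Lam A (App (lift 1 0 f) (Var 0))) f
| conv_UnitInd C d : conv (apps cUnitInd [C; d; Con cStar]) d
| conv_SumInd_inl A B C l r a :
    conv (apps cSumInd [A; B; C; l; r; apps cInl [A; B; a]]) (App l a)
| conv_SumInd_inr A B C l r b :
    conv (apps cSumInd [A; B; C; l; r; apps cInr [A; B; b]]) (App r b)
| conv_NatInd_zero C z s : conv (apps cNatInd [C; z; s; Con cZero]) z
| conv_NatInd_succ C z s n :
    conv (apps cNatInd [C; z; s; App (Con cSucc) n])
         (App (App s n) (apps cNatInd [C; z; s; n]))
| conv_SigInd A B C d a b :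
    conv (apps cSigInd [A; B; C; d; apps cPair [A; B; a; b]]) (App (App d a) b)
| conv_J A a C d : conv (apps cJ [A; a; C; d; a; apps cRefl [A; a]]) d
| conv_TruncRec A P h f a :
    conv (apps cTruncRec [A; P; h; f; apps cTr [A; a]]) (App f a)
| conv_incl_surj A X s f a :
    conv (App (apps cIncl [A; X; s; f]) (App (apps cSurj [A; X; s; f]) a))
         (App f a).

(* An [expr] is a term as a function of the number of variables in scope, so that
   Rocq variables can be used for bound variables: the variable introduced
   at depth [n] has index [m - n - 1] at depth [m].  A closed expression is
   evaluated at depth [0]. *)

Definition expr : Set := nat -> term.

Definition bound (n : nat) : expr := fun m => Var (m - S n).
Definition univ (i : nat) : expr := fun _ => Univ i.
Definition con (c : const) : expr := fun _ => Con c.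
Definition app (f a : expr) : expr := fun n => App (f n) (a n).
Definition pi (A : expr) (B : expr -> expr) : expr :=
  fun n => Pi (A n) (B (bound n) (S n)).
Definition lam (A : expr) (b : expr -> expr) : expr :=
  fun n => Lam (A n) (b (bound n) (S n)).

Declare Scope hott_scope.
Delimit Scope hott_scope with hott.
Bind Scope hott_scope with expr.

Notation U := (univ 0).
Notation TYPE := (univ 1).
Infix "·" := app (at level 40, left associativity) : hott_scope.
Notation "'Π' x : A , B" := (pi A (fun x => B))
  (at level 200, x name, A at level 99, B at level 200,
   format "'[hv' 'Π'  x  :  A , '/'  B ']'") : hott_scope.
Notation "'λ' x : A , b" := (lam A (fun x => b))
  (at level 200, x name, A at level 99, b at level 200,
   format "'[hv' 'λ'  x  :  A , '/'  b ']'") : hott_scope.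
Notation "A ⇒ B" := (pi A (fun _ => B))
  (at level 95, right associativity) : hott_scope.
Notation "'Σ' x : A , B" := (con cSig · A · lam A (fun x => B))%hott
  (at level 200, x name, A at level 99, B at level 200,
   format "'[hv' 'Σ'  x  :  A , '/'  B ']'") : hott_scope.
Notation "'∃' x : A , B" := (con cTrunc · (con cSig · A · lam A (fun x => B)))%hott
  (at level 200, x name, A at level 99, B at level 200,
   format "'[hv' '∃'  x  :  A , '/'  B ']'") : hott_scope.
Notation "x =[ A ] y" := (con cId · A · x · y)%hott
  (at level 70, A at level 99, y at next level,
   format "x  =[ A ]  y") : hott_scope.

Local Open Scope hott_scope.

Definition pair (A : expr) (B : expr -> expr) (a b : expr) : expr :=
  con cPair · A · lam A B · a · b.

(* The projections, the inverse of an equivalence and membership are functions of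
   the theory, so that their arguments are not duplicated. *)

Definition pr1_fun : expr :=
  λ A : TYPE, λ B : A ⇒ TYPE, λ p : (Σ x : A, B · x),
    con cSigInd · A · (λ x : A, B · x) · (λ _ : (Σ x : A, B · x), A)
      · (λ x : A, λ _ : B · x, x) · p.

Definition pr1 (A : expr) (B : expr -> expr) (p : expr) : expr :=
  pr1_fun · A · lam A B · p.

Definition pr2_fun : expr :=
  λ A : TYPE, λ B : A ⇒ TYPE, λ p : (Σ x : A, B · x),
    con cSigInd · A · (λ x : A, B · x)
      · (λ q : (Σ x : A, B · x), B · pr1 A (app B) q)
      · (λ x : A, λ y : B · x, y) · p.

Definition pr2 (A : expr) (B : expr -> expr) (p : expr) : expr :=
  pr2_fun · A · lam A B · p.

Definition isProp (A : expr) : expr := Π x : A, Π y : A, x =[A] y.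

Definition isContr (A : expr) : expr := Σ c : A, Π x : A, c =[A] x.

Definition fiber (A B f b : expr) : expr := Σ a : A, f · a =[B] b.

Definition isEquiv (A B f : expr) : expr := Π b : B, isContr (fiber A B f b).

Definition Equiv (A B : expr) : expr := Σ f : A ⇒ B, isEquiv A B f.

Infix "≃" := Equiv (at level 80) : hott_scope.

Definition inv_fun : expr :=
  λ A : TYPE, λ B : TYPE, λ e : A ≃ B, λ b : B,
    let f := pr1 (A ⇒ B) (isEquiv A B) e in
    let F := fiber A B f b in
    pr1 A (fun a => f · a =[B] b)
      (pr1 F (fun c => Π x : F, c =[F] x) (pr2 (A ⇒ B) (isEquiv A B) e · b)).

Definition inv (A B e b : expr) : expr := inv_fun · A · B · e · b.

Definition idEquiv (A : expr) : expr :=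
  pair (A ⇒ A) (isEquiv A A) (λ x : A, x)
    (λ b : A,
       let F b := fiber A A (λ x : A, x) b in
       let mk b a p := pair A (fun x => (λ x : A, x) · x =[A] b) a p in
       pair (F b) (fun c => Π y : F b, c =[F b] y)
         (mk b b (con cRefl · A · b))
         (λ y : F b,
            con cSigInd · A · (λ a : A, (λ x : A, x) · a =[A] b)
              · (λ y : F b, mk b b (con cRefl · A · b) =[F b] y)
              · (λ a : A, λ p : a =[A] b,
                   con cJ · A · a
                     · (λ b : A, λ p : a =[A] b,
                          mk b b (con cRefl · A · b) =[F b] mk b a p)
                     · (con cRefl · F a · mk a a (con cRefl · A · a))
                     · b · p)
              · y)).

Definition idtoeqv (i : nat) (A B p : expr) : expr :=
  con cJ · univ i · A · (λ X : univ i, λ _ : A =[univ i] X, A ≃ X)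
    · idEquiv A · B · p.

Definition ap (A B f x y p : expr) : expr :=
  con cJ · A · x · (λ z : A, λ _ : x =[A] z, f · x =[B] f · z)
    · (con cRefl · B · (f · x)) · y · p.

Definition isEmb (A B f : expr) : expr :=
  Π x : A, Π y : A,
    isEquiv (x =[A] y) (f · x =[B] f · y)
            (λ p : x =[A] y, ap A B f x y p).

Definition Emb (A B : expr) : expr := Σ f : A ⇒ B, isEmb A B f.

Infix "↪" := Emb (at level 80) : hott_scope.

Definition isSurj (A B f : expr) : expr := Π b : B, con cTrunc · fiber A B f b.

Definition essentiallySmall (A : expr) : expr := Σ B : U, A ≃ B.

Definition locallySmall (X : expr) : expr :=
  Π x : X, Π y : X, essentiallySmall (x =[X] y).

Definition Fin (n : expr) : expr :=
  con cNatInd · (λ _ : con cNat, U) · con cEmpty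
    · (λ _ : con cNat, λ F : U, con cSum · F · con cUnit) · n.

Definition isFinite (A : expr) : expr := ∃ n : con cNat, A ≃ Fin n.

Definition P_U (X : expr) : expr := Σ A : U, A ↪ X.

(* [i] and [j] are universe levels; every constant has the types [ctype c i j]
   for all of them.  From [cUnivalenceU] on they are the axioms: univalence of U and of
   Type, and the image axiom, whose surjection and embedding are given as a map
   together with a proof. *)

Definition forImage (B : expr -> expr -> expr -> expr -> expr) : expr :=
  Π A : U, Π X : TYPE, Π s : locallySmall X, Π f : A ⇒ X, B A X s f.

Definition imageOf (A X s f : expr) : expr := con cImage · A · X · s · f.

Definition ctype (c : const) (i j : nat) : expr :=
  match c with
  | cEmpty => U
  | cEmptyInd =>
      Π C : con cEmpty ⇒ univ j, Π x : con cEmpty, C · x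
  | cUnit => U
  | cStar => con cUnit
  | cUnitInd =>
      Π C : con cUnit ⇒ univ j, C · con cStar ⇒ (Π x : con cUnit, C · x)
  | cSum => univ i ⇒ univ i ⇒ univ i
  | cInl => Π A : univ i, Π B : univ i, A ⇒ con cSum · A · B
  | cInr => Π A : univ i, Π B : univ i, B ⇒ con cSum · A · B
  | cSumInd =>
      Π A : univ i, Π B : univ i, Π C : con cSum · A · B ⇒ univ j,
      (Π a : A, C · (con cInl · A · B · a)) ⇒
      (Π b : B, C · (con cInr · A · B · b)) ⇒
      (Π x : con cSum · A · B, C · x)
  | cNat => TYPE
  | cZero => con cNat
  | cSucc => con cNat ⇒ con cNat
  | cNatInd =>
      Π C : con cNat ⇒ univ j,
      C · con cZero ⇒
      (Π n : con cNat, C · n ⇒ C · (con cSucc · n)) ⇒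
      (Π n : con cNat, C · n)
  | cSig => Π A : univ i, (A ⇒ univ i) ⇒ univ i
  | cPair =>
      Π A : univ i, Π B : A ⇒ univ i, Π a : A, B · a ⇒ con cSig · A · B
  | cSigInd =>
      Π A : univ i, Π B : A ⇒ univ i, Π C : con cSig · A · B ⇒ univ j,
      (Π a : A, Π b : B · a, C · (con cPair · A · B · a · b)) ⇒
      (Π p : con cSig · A · B, C · p)
  | cId => Π A : univ i, A ⇒ A ⇒ univ i
  | cRefl => Π A : univ i, Π a : A, a =[A] a
  | cJ =>
      Π A : univ i, Π a : A, Π C : (Π x : A, (a =[A] x) ⇒ univ j),
      C · a · (con cRefl · A · a) ⇒
      (Π x : A, Π p : a =[A] x, C · x · p)
  | cTrunc => univ i ⇒ univ i
  | cTr => Π A : univ i, A ⇒ con cTrunc · A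
  | cSquash => Π A : univ i, isProp (con cTrunc · A)
  | cTruncRec =>
      Π A : univ i, Π P : univ j,
      isProp P ⇒ (A ⇒ P) ⇒ con cTrunc · A ⇒ P
  | cUnivalenceU =>
      Π A : U, Π B : U,
      isEquiv (A =[U] B) (A ≃ B) (λ p : A =[U] B, idtoeqv 0 A B p)
  | cUnivalenceType =>
      Π A : TYPE, Π B : TYPE,
      isEquiv (A =[TYPE] B) (A ≃ B) (λ p : A =[TYPE] B, idtoeqv 1 A B p)
  | cImage => forImage (fun A X s f => U)
  | cSurj => forImage (fun A X s f => A ⇒ imageOf A X s f)
  | cSurjIsSurj =>
      forImage (fun A X s f =>
        isSurj A (imageOf A X s f) (con cSurj · A · X · s · f))
  | cIncl => forImage (fun A X s f => imageOf A X s f ⇒ X)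
  | cInclIsEmb =>
      forImage (fun A X s f =>
        isEmb (imageOf A X s f) X (con cIncl · A · X · s · f))
  end.

(* Contexts need no separate well-formedness judgement: starting from the empty
   context, the rules only ever add types to it. *)

Reserved Notation "Γ ⊢ t ∈ T" (at level 70, t at level 69, T at level 69).

Inductive typed : list term -> term -> term -> Prop :=
| ty_var Γ n A :
    nth_error Γ n = Some A ->
    Γ ⊢ Var n ∈ lift (S n) 0 A
| ty_univ Γ i :
    Γ ⊢ Univ i ∈ Univ (S i)
| ty_cumul Γ A i :
    Γ ⊢ A ∈ Univ i ->
    Γ ⊢ A ∈ Univ (S i)
| ty_pi Γ A B i :
    Γ ⊢ A ∈ Univ i ->
    (A :: Γ) ⊢ B ∈ Univ i ->
    Γ ⊢ Pi A B ∈ Univ i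
| ty_lam Γ A B b i :
    Γ ⊢ A ∈ Univ i ->
    (A :: Γ) ⊢ b ∈ B ->
    Γ ⊢ Lam A b ∈ Pi A B
| ty_app Γ A B f a :
    Γ ⊢ f ∈ Pi A B ->
    Γ ⊢ a ∈ A ->
    Γ ⊢ App f a ∈ subst a 0 B
| ty_con Γ c i j :
    Γ ⊢ Con c ∈ ctype c i j 0
| ty_conv Γ t A B i :
    Γ ⊢ t ∈ A ->
    conv A B ->
    Γ ⊢ B ∈ Univ i ->
    Γ ⊢ t ∈ B
where "Γ ⊢ t ∈ T" := (typed Γ t T).

Definition HoTT_with_images_proves (T : expr) : Prop :=
  exists t : term, [] ⊢ t ∈ T 0.

(* x ∈ y for an equivalence sup : P_U V ≃ V.  Writing y as sup (A, f) means
   taking apart sup^-1 y. *)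
Definition mem_fun : expr :=
  λ V : TYPE, λ sup : P_U V ≃ V, λ x : V, λ y : V,
    con cSigInd · U · (λ A : U, A ↪ V) · (λ _ : P_U V, TYPE)
      · (λ A : U, λ f : A ↪ V,
           Σ a : A, pr1 (A ⇒ V) (isEmb A V) f · a =[V] x)
      · inv (P_U V) V sup y.

Definition mem (V sup x y : expr) : expr := mem_fun · V · sup · x · y.

Definition hasFinitePropositionalTupling
    (V : expr) (mem : expr -> expr -> expr) : expr :=
  Π A : TYPE, isFinite A ⇒
  (Π v : A ⇒ V,
     Σ w : V, Π z : V, mem z w ≃ (∃ a : A, v · a =[V] z)).

(* Main.v *)
(* Given v : A -> V with A finite, it is enough to find a B : U equivalent to A: then
   A may be replaced by B, by univalence, and {v} is sup (image v, incl v).  Indeed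
   z ∈ {v} is the fiber of incl v over z, which is a proposition because incl v is an
   embedding, and it is logically equivalent to ∃ a, v a = z because surj v is
   surjective.  For A merely equivalent to some Fin n, such a B may be chosen since
   Σ (B : U), A ≃ B is a proposition: after replacing A by B0 : U it is, by univalence
   of U, a singleton.  Function extensionality is never needed.

   The inhabitant is written down as a term, and its typing derivation is obtained by
   running a type checker that is proved sound (it need not be complete). *)

Require Import Defs.
From Stdlib Require Import List Arith Lia Bool.
Import ListNotations.
(* [&&] and [||] would evaluate both arguments under call by value. *)
Local Open Scope lazy_bool_scope.

(** * A sound type checker *)

Lemma andb_lazy_true (a b : bool) : (a &&& b) = true -> a = true /\ b = true.
Proof. now destruct a. Qed.

Lemma orb_lazy_true (a b : bool) : (a ||| b) = true -> a = true \/ b = true.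
Proof. destruct a; auto. Qed.

(** * Reduction and conversion *)

Fixpoint spine (t : term) (l : list term) : option (const * list term) :=
  match t with
  | App f a => spine f (a :: l)
  | Con c => Some (c, l)
  | _ => None
  end.

Scheme Equality for const.

Fixpoint term_eqb (t u : term) : bool :=
  match t, u with
  | Var n, Var m => n =? m
  | Univ i, Univ j => i =? j
  | Pi A B, Pi A' B' | Lam A B, Lam A' B' | App A B, App A' B' =>
      term_eqb A A' &&& term_eqb B B'
  | Con c, Con c' => const_beq c c'
  | _, _ => false
  end.

Fixpoint forallb2 (p : term -> term -> bool) (l m : list term) : bool :=
  match l, m with
  | [], [] => true
  | x :: l, y :: m => p x y &&& forallb2 p l m
  | _, _ => false
  end.

(* The remaining computation rules are not needed for the inhabitant below. *)
Definition iota (wh : term -> term) (cv : term -> term -> bool) (t : term) : option term :=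
  match spine t [] with
  | Some (cSigInd, [A; B; C; d; p]) =>
      match spine (wh p) [] with
      | Some (cPair, [A'; B'; a; b]) =>
          (* The computation rule has the same parameters in eliminator and constructor, so they
             must be convertible before the redex fires. *)
          if forallb2 cv [A'; B'] [A; B] then Some (App (App d a) b) else None
      | _ => None
      end
  | Some (cJ, [A; a; C; d; x; p]) =>
      match spine (wh p) [] with
      | Some (cRefl, [A'; a']) =>
          if forallb2 cv [A'; a'; x] [A; a; a] then Some d else None
      | _ => None
      end
  | Some (cIncl, [A; X; s; f; i]) =>
      match spine (wh i) [] with
      | Some (cSurj, [A'; X'; s'; f'; a]) =>
          if forallb2 cv [A'; X'; s'; f'] [A; X; s; f] then Some (App f a) else None
      | _ => None
      end
  | _ => None
  end.

(** Without fuel the answers are the term itself and [false], both safe, so soundness holds for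
    every [n]. The recursion is mutual because [iota] compares parameters up to conversion. *)
Fixpoint whnf (n : nat) (t : term) : term :=
  match n with
  | 0 => t
  | S n =>
      match t with
      | App f a =>
          match whnf n f with
          | Lam _ b => whnf n (subst a 0 b)
          | f' =>
              match iota (whnf n) (convb n) (App f' a) with
              | Some u => whnf n u
              | None => App f' a
              end
          end
      | _ => t
      end
  end
with convb (n : nat) (t u : term) : bool :=
  match n with
  | 0 => false
  | S n =>
      if term_eqb t u then true else
      match whnf n t, whnf n u with
      | Var k, Var l => k =? l
      | Univ i, Univ j => i =? j
      | Con c, Con d => const_beq c d
      | Pi A B, Pi A' B' | Lam A B, Lam A' B' | App A B, App A' B' =>
          convb n A A' &&& convb n B B'
      | _, _ => false
      end
  end.

Lemma spine_sound t l c m : spine t l = Some (c, m) -> fold_left App l t = apps c m.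
Proof.
  revert l; induction t; simpl; intros l H; try discriminate.
  - apply (IHt1 (_ :: l) H).
  - now injection H as -> ->.
Qed.

Lemma const_beq_sound c d : const_beq c d = true -> c = d.
Proof. apply internal_const_dec_bl. Qed.

Lemma term_eqb_sound t u : term_eqb t u = true -> t = u.
Proof.
  revert u; induction t; destruct u; simpl; try discriminate; intros H;
    try (apply andb_lazy_true in H as [H1 H2]);
    f_equal; auto using const_beq_sound; now apply Nat.eqb_eq.
Qed.

Lemma lift0 c t : lift 0 c t = t.
Proof. revert c; induction t; intros; simpl; f_equal; auto; now destruct (n <? c). Qed.

Lemma subst_lift u c t : subst u c (lift 1 c t) = t.
Proof.
  revert c; induction t; intros; cbn -[Nat.ltb Nat.eqb Nat.add]; f_equal; auto.
  destruct (Nat.ltb_spec n c); cbn -[Nat.ltb Nat.eqb Nat.add].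
  - now destruct (Nat.ltb_spec n c); [|lia].
  - destruct (Nat.ltb_spec (1 + n) c); [lia|].
    now destruct (Nat.eqb_spec (1 + n) c); [lia|].
Qed.

Lemma conv_apps c l m : Forall2 conv l m -> conv (apps c l) (apps c m).
Proof.
  (* [fold_left] changes its head, so the induction runs over two convertible heads in place of
     [Con c]. *)
  unfold apps; generalize (conv_refl (Con c)); generalize (Con c) at 1 3 as t.
  generalize (Con c) as u; intros u t Htu H; revert t u Htu.
  induction H; simpl; auto using conv_App.
Qed.

Lemma forallb2_sound cv (Hcv : forall t u, cv t u = true -> conv t u) l m :
  forallb2 cv l m = true -> Forall2 conv l m.
Proof.
  revert m; induction l; destruct m; simpl; try discriminate; auto.
  intros [H1 H2]%andb_lazy_true; auto.
Qed.

Local Ltac conv_list := repeat apply Forall2_cons; auto using Forall2_nil, conv_refl.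

Lemma iota_sound wh cv t u :
  (forall t, conv t (wh t)) -> (forall t u, cv t u = true -> conv t u) ->
  iota wh cv t = Some u -> conv t u.
Proof.
  intros Hwh Hcv.
  assert (Hspine : forall t c l, spine (wh t) [] = Some (c, l) -> conv t (apps c l)).
  { intros t' c l H%spine_sound; simpl in H; rewrite <- H; apply Hwh. }
  unfold iota; destruct (spine t []) as [[c l]|] eqn:E; [|discriminate].
  apply spine_sound in E; simpl in E; subst t.
  destruct c; try discriminate; intros H;
    repeat (match type of H with
            | context [match ?x with _ => _ end] =>
                first [is_var x; destruct x | destruct x eqn:?]
            end; try discriminate);
    injection H as <-;
    match goal with
    | S : spine _ _ = Some _, L : forallb2 _ _ _ = true |- _ =>
        apply Hspine in S; apply (forallb2_sound cv Hcv) in L;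
        repeat match goal with L : Forall2 _ (_ :: _) _ |- _ => inversion_clear L end
    end.
  - eapply conv_trans; [|apply conv_SigInd].
    apply conv_apps; conv_list.
    eapply conv_trans; [eassumption|].
    apply conv_apps; conv_list.
  - eapply conv_trans; [|apply conv_J].
    apply conv_apps; conv_list.
    eapply conv_trans; [eassumption|].
    apply conv_apps; conv_list.
  - refine (conv_trans _ (apps cIncl [_; _; _; _; apps cSurj [_; _; _; _; _]]) _ _
              (conv_incl_surj _ _ _ _ _)).
    apply conv_apps; conv_list.
    eapply conv_trans; [eassumption|].
    apply conv_apps; conv_list.
Qed.

Lemma whnf_convb_sound n :
  (forall t, conv t (whnf n t)) /\ (forall t u, convb n t u = true -> conv t u).
Proof.
  induction n as [|n [IHw IHc]]; simpl.
  { split; [intros; apply conv_refl | discriminate]. }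
  split.
  - intros t; destruct t as [| | | |f a|]; try apply conv_refl.
    assert (Hf : conv (App f a) (App (whnf n f) a)) by auto using conv_App, conv_refl.
    assert (Hi : conv (App f a)
        match iota (whnf n) (convb n) (App (whnf n f) a) with
        | Some u => whnf n u
        | None => App (whnf n f) a
        end).
    { destruct iota eqn:E; [|assumption].
      eapply conv_trans; [eassumption|]; eapply conv_trans; [|apply IHw].
      exact (iota_sound _ _ _ _ IHw IHc E). }
    destruct (whnf n f); try exact Hi.
    eapply conv_trans; [eassumption|]; eapply conv_trans; [apply conv_beta|apply IHw].
  - intros t u.
    destruct (term_eqb t u) eqn:E; [apply term_eqb_sound in E as ->; intros _; apply conv_refl|].
    clear E; intros H.
    eapply conv_trans; [apply IHw|]; eapply conv_trans; [|apply conv_sym, IHw].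
    destruct (whnf n t), (whnf n u); try discriminate;
      try (apply andb_lazy_true in H as []);
      try (apply conv_Pi + apply conv_Lam + apply conv_App; apply IHc; assumption);
      try (apply Nat.eqb_eq in H as ->; apply conv_refl);
      try (apply const_beq_sound in H as ->; apply conv_refl).
Qed.

Definition whnf_sound n := proj1 (whnf_convb_sound n).
Definition convb_sound n := proj2 (whnf_convb_sound n).

(** * Type inference and checking *)

Definition as_univ (n : nat) (T : option term) : option nat :=
  match T with
  | Some T => match whnf n T with Univ i => Some i | _ => None end
  | None => None
  end.

(** A visible product costs no conversion; one reached by reduction needs a level, as [ty_conv]
    demands a well-formed target. *)
Definition to_pi (n : nat) (lev : term -> option nat) (T : term) : option (term * term) :=
  match T with
  | Pi A B => Some (A, B)
  | _ => match whnf n T with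
         | Pi A B => match lev (Pi A B) with Some _ => Some (A, B) | None => None end
         | _ => None
         end
  end.

Inductive former : Set :=
| fSig (A A' B : term)
| fId (A x y : term)
| fTrunc (A : term)
| fSum (A B : term).

Definition as_former (t : term) : option former :=
  match spine t [] with
  | Some (cSig, [A; Lam A' B]) => Some (fSig A A' B)
  | Some (cId, [A; x; y]) => Some (fId A x y)
  | Some (cTrunc, [A]) => Some (fTrunc A)
  | Some (cSum, [A; B]) => Some (fSum A B)
  | _ => None
  end.

Definition former_term (F : former) : term :=
  match F with
  | fSig A A' B => apps cSig [A; Lam A' B]
  | fId A x y => apps cId [A; x; y]
  | fTrunc A => apps cTrunc [A]
  | fSum A B => apps cSum [A; B]
  end.

Lemma as_former_sound t F : as_former t = Some F -> t = former_term F.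
Proof.
  unfold as_former; destruct (spine t []) as [[c l]|] eqn:E; [|discriminate].
  apply spine_sound in E; simpl in E; subst t.
  destruct c; try discriminate; destruct l as [|A [|B [|C [|]]]]; try discriminate;
    try destruct B; try discriminate; now intros [= <-].
Qed.

(* The level of a type former is computed from its arguments because it determines the
   universe of the result; for the other constants it leaves no trace in the type of a
   full application, so the highest level that occurs, 2, is used throughout.  Types
   are checked again whenever [ty_conv] is applied, which avoids having to prove that
   the type of a typed term is well-formed. *)
Fixpoint infer (n : nat) (Γ : list term) (t : term) : option term :=
  match n with
  | 0 => None
  | S n =>
      let level Γ A := as_univ n (infer n Γ A) in
      match t with
      | Var k => option_map (lift (S k) 0) (nth_error Γ k)
      | Univ i => Some (Univ (S i))
      | Con c => Some (ctype c 2 2 0)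
      | Pi A B =>
          match level Γ A, level (A :: Γ) B with
          | Some i, Some j => Some (Univ (max i j))
          | _, _ => None
          end
      | Lam A b =>
          match level Γ A, infer n (A :: Γ) b with
          | Some _, Some B => Some (Pi A B)
          | _, _ => None
          end
      | App f a =>
          match as_former t with
          | Some (fSig A A' B) =>
              match level Γ A, level (A :: Γ) B with
              | Some i, Some j => if term_eqb A A' then Some (Univ (max i j)) else None
              | _, _ => None
              end
          | Some (fId A x y) =>
              match level Γ A with
              | Some i => if check n Γ x A &&& check n Γ y A then Some (Univ i) else None
              | None => None
              end
          | Some (fTrunc A) => option_map Univ (level Γ A)
          | Some (fSum A B) =>
              match level Γ A, level Γ B with
              | Some i, Some j => Some (Univ (max i j))
              | _, _ => None
              end
          | None =>
              match infer n Γ f with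
              | Some F =>
                  match to_pi n (level Γ) F with
                  | Some (A, B) => if check n Γ a A then Some (subst a 0 B) else None
                  | None => None
                  end
              | None => None
              end
          end
      end
  end
with check (n : nat) (Γ : list term) (t T : term) : bool :=
  match n with
  | 0 => false
  | S n =>
      let level Γ A := as_univ n (infer n Γ A) in
      (* The dummy argument delays this branch under call by value. *)
      let general _ :=
        match infer n Γ t with
        | Some T' =>
            term_eqb T' T |||
            (convb n T' T &&& match level Γ T with Some _ => true | None => false end)
        | None => false
        end in
      match T with
      | Univ i => match level Γ t with Some j => j <=? i | None => false end
      | Pi A B =>
          match t with
          | Lam A' b =>
              if term_eqb A' A
              then match level Γ A with Some _ => check n (A :: Γ) b B | None => false end
              else general tt
          | _ => general tt
          end
      | _ => general tt
      end
  end.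

Lemma ty_cumul_le Γ A i j : i <= j -> typed Γ A (Univ i) -> typed Γ A (Univ j).
Proof. induction 1; auto using ty_cumul. Qed.

Lemma as_univ_sound n Γ t T i :
  (forall U, T = Some U -> typed Γ t U) -> as_univ n T = Some i -> typed Γ t (Univ i).
Proof.
  destruct T as [T|]; simpl; [|discriminate].
  intros H E; specialize (H _ eq_refl).
  assert (C := whnf_sound n T); destruct (whnf n T); try discriminate.
  injection E as ->; eapply ty_conv; [eassumption..|apply ty_univ].
Qed.

Lemma to_pi_sound n Γ lev t T A B :
  (forall A i, lev A = Some i -> typed Γ A (Univ i)) ->
  typed Γ t T -> to_pi n lev T = Some (A, B) -> typed Γ t (Pi A B).
Proof.
  intros Hlev Ht E; unfold to_pi in E.
  assert (C := whnf_sound n T).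
  assert (G : match whnf n T with
         | Pi A B => match lev (Pi A B) with Some _ => Some (A, B) | None => None end
         | _ => None
         end = Some (A, B) -> typed Γ t (Pi A B)).
  { destruct (whnf n T); try discriminate.
    destruct lev eqn:L; try discriminate.
    intros [= -> ->]; eapply ty_conv; eauto. }
  destruct T; auto.
  now injection E as -> ->.
Qed.

Lemma infer_check_sound n :
  (forall Γ t T, infer n Γ t = Some T -> typed Γ t T) /\
  (forall Γ t T, check n Γ t T = true -> typed Γ t T).
Proof.
  induction n as [|n [IHi IHc]]; [split; discriminate|].
  assert (IHl : forall Γ A i, as_univ n (infer n Γ A) = Some i -> typed Γ A (Univ i)).
  { intros Γ A i; apply as_univ_sound; auto. }
  split; intros Γ t T.
  - destruct t as [k|i|A B|A b|f a|c]; simpl.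
    + destruct nth_error eqn:E; simpl; [|discriminate].
      intros [= <-]; now apply ty_var.
    + intros [= <-]; apply ty_univ.
    + destruct as_univ as [i|] eqn:EA; [|discriminate].
      destruct (as_univ n (infer n (A :: Γ) B)) as [j|] eqn:EB; [|discriminate].
      intros [= <-]; apply ty_pi; (eapply ty_cumul_le; [|apply IHl; eassumption]); lia.
    + destruct as_univ as [i|] eqn:EA; [|discriminate].
      destruct (infer n (A :: Γ) b) eqn:EB; [|discriminate].
      intros [= <-]; eapply ty_lam; eauto.
    + set (G := match infer n Γ f with Some _ => _ | None => None end).
      assert (HG : G = Some T -> typed Γ (App f a) T).
      { unfold G; destruct (infer n Γ f) as [F|] eqn:EF; [|discriminate].
        destruct (to_pi n (fun A => as_univ n (infer n Γ A)) F) as [[A B]|] eqn:EP; [|discriminate].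
        destruct (check n Γ a A) eqn:EA; [|discriminate].
        intros [= <-]; eapply ty_app; [|eauto].
        eapply to_pi_sound; [|eauto|eassumption]; eauto. }
      clearbody G.
      destruct (as_former (App f a)) as [F|] eqn:EF; [|exact HG].
      apply as_former_sound in EF; rewrite EF; clear EF HG.
      destruct F as [A A' B|A x y|A|A B]; simpl;
        (destruct (as_univ n (infer n Γ A)) as [i|] eqn:EA; [|discriminate]);
        apply IHl in EA; simpl.
      * destruct (as_univ n (infer n (A :: Γ) B)) as [j|] eqn:EB; [|discriminate].
        apply IHl in EB.
        destruct (term_eqb A A') eqn:E; [|discriminate]; apply term_eqb_sound in E as <-.
        intros [= <-].
        refine (ty_app _ _ _ _ _ (ty_app _ _ _ _ _ (ty_con _ cSig (max i j) 0) _) _); simpl.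
        -- eapply ty_cumul_le; [|eassumption]; lia.
        -- rewrite lift0; eapply ty_lam; [eassumption|].
           eapply ty_cumul_le; [|eassumption]; lia.
      * destruct (check n Γ x A) eqn:Ex; [|discriminate].
        destruct (check n Γ y A) eqn:Ey; [|discriminate].
        intros [= <-].
        refine (ty_app Γ A (Univ i) (apps cId [A; x]) y _ (IHc _ _ _ Ey)).
        (* [ty_app] yields a substituted type, so [A] is presented as an instance of its own
           lift. *)
        rewrite <- (subst_lift x 0 A) at 2.
        refine (ty_app Γ A (Pi (lift 1 0 A) (Univ i)) (apps cId [A]) x _ (IHc _ _ _ Ex)).
        rewrite <- (lift0 0 A) at 2.
        exact (ty_app _ _ _ _ _ (ty_con _ cId i 0) EA).
      * intros [= <-].
        exact (ty_app _ _ _ _ _ (ty_con _ cTrunc i 0) EA).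
      * destruct (as_univ n (infer n Γ B)) as [j|] eqn:EB; [|discriminate].
        apply IHl in EB; intros [= <-].
        refine (ty_app _ _ _ _ _ (ty_app _ _ _ _ _ (ty_con _ cSum (max i j) 0) _) _);
          (eapply ty_cumul_le; [|eassumption]; lia).
    + intros [= <-]; apply ty_con.
  - simpl.
    set (G := match infer n Γ t with Some _ => _ | None => false end).
    assert (HG : G = true -> typed Γ t T).
    { unfold G; destruct (infer n Γ t) as [T'|] eqn:E; [|discriminate].
      intros [->%term_eqb_sound|[H1 H2]%andb_lazy_true]%orb_lazy_true; auto.
      destruct as_univ eqn:L; [|discriminate].
      eapply ty_conv; eauto using convb_sound. }
    clearbody G.
    destruct T as [ |i|A B| | |]; auto.
    + destruct as_univ as [j|] eqn:L; [|discriminate].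
      intros H%Nat.leb_le; eauto using ty_cumul_le.
    + destruct t as [| | |A' b| |]; auto.
      destruct (term_eqb A' A) eqn:E; auto; apply term_eqb_sound in E as ->.
      destruct as_univ as [j|] eqn:L; [|discriminate].
      intros H; eapply ty_lam; eauto.
Qed.

Lemma proves_of_check n t T : check n [] (t 0) (T 0) = true -> HoTT_with_images_proves T.
Proof. intros H; exists (t 0); now apply infer_check_sound in H. Qed.

(** * The inhabitant *)

Local Open Scope hott_scope.

(** A type ascription as a beta-redex: [t] is checked against [T], and the application is inferred
    to have exactly the type [T]. *)
Definition the (T t : expr) : expr := (λ x : T, x) · t.

(** * Paths, propositions and embeddings *)

Definition refl (A a : expr) : expr := con cRefl · A · a.

Definition J (A a : expr) (C : expr -> expr -> expr) (d x p : expr) : expr :=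
  con cJ · A · a · (λ x : A, λ p : a =[A] x, C x p) · d · x · p.

Definition sigInd (A : expr) (B : expr -> expr) (C : expr -> expr)
    (d : expr -> expr -> expr) (p : expr) : expr :=
  con cSigInd · A · lam A B · (λ p : (Σ x : A, B x), C p)
    · (λ a : A, λ b : B a, d a b) · p.

(** The inverse of [p] followed by [q]; it computes to [q] when [p] is reflexivity. *)
Definition inv_trans (A x y z p q : expr) : expr :=
  J A x (fun y _ => x =[A] z ⇒ y =[A] z) (λ q : x =[A] z, q) y p · q.

(* Every [p : x = y] equals [(h x x)^-1 @ h x y], by induction on [p]. *)
Definition isSet_of_isProp : expr :=
  the (Π P : TYPE, isProp P ⇒ (Π x : P, Π y : P, isProp (x =[P] y)))
  (λ P : TYPE, λ h : isProp P, λ x : P, λ y : P, λ p : x =[P] y, λ q : x =[P] y,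
    let c y := inv_trans P x x y (h · x · x) (h · x · y) in
    let inverse :=
      J P x (fun y r => inv_trans P x y y r r =[y =[P] y] refl P y)
        (refl (x =[P] x) (refl P x)) x (h · x · x) in
    let canonical p := J P x (fun y p => c y =[x =[P] y] p) inverse y p in
    inv_trans (x =[P] y) (c y) p q (canonical p) (canonical q)).

(** The fibre over [q] is centred at [g q]. Another point [(p, r)] is reached along [hP], after
    which the two paths in [Q] agree because [Q] is a set. *)
Definition equiv_of_isProp : expr :=
  the (Π P : TYPE, Π Q : TYPE, isProp P ⇒ isProp Q ⇒ (P ⇒ Q) ⇒ (Q ⇒ P) ⇒ P ≃ Q)
  (λ P : TYPE, λ Q : TYPE, λ hP : isProp P, λ hQ : isProp Q, λ f : P ⇒ Q, λ g : Q ⇒ P,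
    pair (P ⇒ Q) (isEquiv P Q) f
      (λ q : Q,
         let F := fiber P Q f q in
         let mk p r := pair P (fun p => f · p =[Q] q) p r in
         let s := hQ · (f · (g · q)) · q in
         let c := mk (g · q) s in
         pair F (fun c => Π y : F, c =[F] y) c
           (λ y : F,
              sigInd P (fun p => f · p =[Q] q) (fun y => c =[F] y)
                (fun p r =>
                   (* The motive quantifies over [r], whose type varies with [p]. *)
                   J P (g · q) (fun p _ => Π r : f · p =[Q] q, c =[F] mk p r)
                     (λ r : f · (g · q) =[Q] q,
                        J (f · (g · q) =[Q] q) s (fun r _ => c =[F] mk (g · q) r)
                          (refl F c)
                          r (isSet_of_isProp · Q · hQ · (f · (g · q)) · q · s · r))
                     p (hP · (g · q) · p) · r)
                y))).

(* At level 2 so as to apply to [A =[TYPE] B]; for the same reason [pr1], which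
   is confined to TYPE, is avoided here. *)
Definition equiv_ind : expr :=
  the (Π X : univ 2, Π Y : univ 2, Π f : X ⇒ Y, isEquiv X Y f ⇒
       (Π C : Y ⇒ univ 2, (Π x : X, C · (f · x)) ⇒ (Π y : Y, C · y)))
  (λ X : univ 2, λ Y : univ 2, λ f : X ⇒ Y, λ h : isEquiv X Y f,
   λ C : Y ⇒ univ 2, λ d : (Π x : X, C · (f · x)), λ y : Y,
    let F := fiber X Y f y in
    sigInd X (fun x => f · x =[Y] y) (fun _ => C · y)
      (fun x p => J Y (f · x) (fun y _ => C · y) (d · x) y p)
      (sigInd F (fun c => Π z : F, c =[F] z) (fun _ => F) (fun c _ => c) (h · y))).

(* After induction on [q], [p] is a path between values of the embedding [f], hence
   of the form [ap f r]. *)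
Definition isProp_fiber_of_isEmb : expr :=
  the (Π A : TYPE, Π B : TYPE, Π f : A ⇒ B, isEmb A B f ⇒
       (Π b : B, isProp (fiber A B f b)))
  (λ A : TYPE, λ B : TYPE, λ f : A ⇒ B, λ h : isEmb A B f,
   λ b : B, λ u : fiber A B f b, λ v : fiber A B f b,
    let mk b a p := pair A (fun a => f · a =[B] b) a p in
    let path b x p y q := mk b x p =[fiber A B f b] mk b y q in
    sigInd A (fun a => f · a =[B] b) (fun u => u =[fiber A B f b] v)
      (fun x p =>
         sigInd A (fun a => f · a =[B] b) (fun v => mk b x p =[fiber A B f b] v)
           (fun y q =>
              J B (f · y) (fun b q => Π p : f · x =[B] b, path b x p y q)
                (equiv_ind · (x =[A] y) · (f · x =[B] f · y)
                   · (λ r : x =[A] y, ap A B f x y r) · (h · x · y)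
                   · (λ p : f · x =[B] f · y, path (f · y) x p y (refl B (f · y)))
                   · (λ r : x =[A] y,
                        J A x
                          (fun y r => path (f · y) x (ap A B f x y r) y (refl B (f · y)))
                          (refl (fiber A B f (f · x)) (mk (f · x) x (refl B (f · x))))
                          y r))
                b q · p)
           v)
      u).

(** * Univalence and essential smallness *)

Definition isProp_Equiv_singleton : expr :=
  the (Π A : U, isProp (Σ B : U, A ≃ B))
  (λ A : U,
    let S := (Σ B : U, A ≃ B) in
    let mk B e := pair U (fun B => A ≃ B) B e in
    let c := mk A (idEquiv A) in
    let path v :=
      sigInd U (fun B => A ≃ B) (fun v => c =[S] v)
        (fun B e =>
           (* Univalence presents [e] as [idtoeqv] of a path [p]; at reflexivity this computes to
              [idEquiv A], so path induction contracts the pair to [c]. *)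
           equiv_ind · (A =[U] B) · (A ≃ B) · (λ p : A =[U] B, idtoeqv 0 A B p)
             · (con cUnivalenceU · A · B)
             · (λ e : A ≃ B, c =[S] mk B e)
             · (λ p : A =[U] B,
                 J U A (fun B p => c =[S] mk B (idtoeqv 0 A B p)) (refl S c) B p)
             · e)
        v in
    λ u : S, λ v : S, inv_trans S c u v (path u) (path v)).

(** The direction is from [B] to [A] because properties are established for a small [B] and wanted
    for [A]. *)
Definition transport_Equiv : expr :=
  the (Π P : TYPE ⇒ TYPE, Π A : TYPE, Π B : TYPE, A ≃ B ⇒ P · B ⇒ P · A)
  (λ P : TYPE ⇒ TYPE, λ A : TYPE, λ B : TYPE,
    equiv_ind · (A =[TYPE] B) · (A ≃ B) · (λ p : A =[TYPE] B, idtoeqv 1 A B p)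
      · (con cUnivalenceType · A · B)
      · (λ _ : A ≃ B, P · B ⇒ P · A)
      · (λ p : A =[TYPE] B,
           J TYPE A (fun B _ => P · B ⇒ P · A) (λ x : P · A, x) B p)).

(** The point [u] itself supplies a [B : U] equivalent to [A]; transport replaces [A] by [B], where
    the singleton argument applies. *)
Definition isProp_essentiallySmall : expr :=
  the (Π A : TYPE, isProp (essentiallySmall A))
  (λ A : TYPE, λ u : essentiallySmall A, λ v : essentiallySmall A,
    sigInd U (fun B => A ≃ B) (fun _ => isProp (essentiallySmall A))
      (fun B e =>
         transport_Equiv · (λ X : TYPE, isProp (essentiallySmall X)) · A · B · e
           · (isProp_Equiv_singleton · B))
      u · u · v).

(** The truncation is eliminated here, into a proposition, so that tupling can start from an
    untruncated [B]. *)
Definition essentiallySmall_of_isFinite : expr :=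
  the (Π A : TYPE, isFinite A ⇒ essentiallySmall A)
  (λ A : TYPE, λ h : isFinite A,
    con cTruncRec · (Σ n : con cNat, A ≃ Fin n) · essentiallySmall A
      · (isProp_essentiallySmall · A)
      · (λ x : (Σ n : con cNat, A ≃ Fin n),
           sigInd (con cNat) (fun n => A ≃ Fin n) (fun _ => essentiallySmall A)
             (fun n e => pair U (fun B => A ≃ B) (Fin n) e) x)
      · h).

(** * Fibres of the image inclusion, and tupling *)

(* [cIncl (cSurj a)] and [f a] are judgementally equal, so paths from either to [z]
   are interchanged without transport. *)
Definition fiber_incl_equiv : expr :=
  the (Π A : U, Π V : TYPE, Π s : locallySmall V, Π f : A ⇒ V, Π z : V,
       fiber (imageOf A V s f) V (con cIncl · A · V · s · f) z
         ≃ (∃ a : A, f · a =[V] z))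
  (λ A : U, λ V : TYPE, λ s : locallySmall V, λ f : A ⇒ V, λ z : V,
    let I := imageOf A V s f in
    let incl := con cIncl · A · V · s · f in
    let surj := con cSurj · A · V · s · f in
    let P := fiber I V incl z in
    let Q := Σ a : A, f · a =[V] z in
    let hP := isProp_fiber_of_isEmb · I · V · incl
                · (con cInclIsEmb · A · V · s · f) · z in
    equiv_of_isProp · P · (con cTrunc · Q) · hP · (con cSquash · Q)
      · (λ u : P,
           sigInd I (fun i => incl · i =[V] z) (fun _ => con cTrunc · Q)
             (fun i p =>
                con cTruncRec · fiber A I surj i · (con cTrunc · Q) · (con cSquash · Q)
                  · (λ t : fiber A I surj i,
                       sigInd A (fun a => surj · a =[I] i) (fun _ => con cTrunc · Q)
                         (fun a q =>
                            J I (surj · a) (fun i _ => incl · i =[V] z ⇒ con cTrunc · Q)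
                              (λ p : f · a =[V] z,
                                 con cTr · Q · pair A (fun a => f · a =[V] z) a p)
                              i q · p)
                         t)
                  · (con cSurjIsSurj · A · V · s · f · i))
             u)
      · (λ t : con cTrunc · Q,
           con cTruncRec · Q · P · hP
             · (λ t : Q,
                  sigInd A (fun a => f · a =[V] z) (fun _ => P)
                    (fun a p => pair I (fun i => incl · i =[V] z) (surj · a) p) t)
             · t)).

(* Transport along [inv e (e x) = x].  [R] and [P] stand for judgementally equal
   unfoldings of [C] and are related to it by identities rather than by conversion:
   [_ ≃ Q] mentions its argument many times, and each occurrence would otherwise be
   unfolded separately by the checker. *)
Definition inv_equiv : expr :=
  the (Π X : TYPE, Π Y : TYPE, Π e : X ≃ Y, Π C : X ⇒ TYPE, Π R : Y ⇒ TYPE,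
       (Π y : Y, C · inv X Y e y =[TYPE] R · y) ⇒
       (Π x : X, Π P : TYPE, C · x =[TYPE] P ⇒
       (Π Q : TYPE, P ≃ Q ⇒ R · (pr1 (X ⇒ Y) (isEquiv X Y) e · x) ≃ Q)))
  (λ X : TYPE, λ Y : TYPE, λ e : X ≃ Y, λ C : X ⇒ TYPE, λ R : Y ⇒ TYPE,
   λ r : (Π y : Y, C · inv X Y e y =[TYPE] R · y),
   λ x : X, λ P : TYPE, λ p : C · x =[TYPE] P, λ Q : TYPE, λ d : P ≃ Q,
    let f := pr1 (X ⇒ Y) (isEquiv X Y) e in
    let F := fiber X Y f (f · x) in
    let contr := pr2 (X ⇒ Y) (isEquiv X Y) e · (f · x) in
    let center := pr1 F (fun c => Π y : F, c =[F] y) contr in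
    let point := pair X (fun a => f · a =[Y] f · x) x (refl Y (f · x)) in
    let fst y := pr1 X (fun a => f · a =[Y] f · x) y in
    J TYPE (C · inv X Y e (f · x)) (fun Z _ => Z ≃ Q)
      (* [inv] of [f x] is judgementally the first component of [center]; contractibility joins
         [center] to [point], whose first component is [x]. *)
      (J F center (fun y _ => C · fst y ≃ Q ⇒ C · fst center ≃ Q)
         (λ d : C · fst center ≃ Q, d)
         point (pr2 F (fun c => Π y : F, c =[F] y) contr · point)
       · (J TYPE (C · x) (fun P _ => P ≃ Q ⇒ C · x ≃ Q) (λ d : C · x ≃ Q, d) P p · d))
      (R · (f · x)) (r · (f · x))).

Definition tupling (V sup A : expr) : expr :=
  Π v : A ⇒ V, Σ w : V, Π z : V, mem V sup z w ≃ (∃ a : A, v · a =[V] z).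

Definition tupling_small : expr :=
  the (Π V : TYPE, Π s : locallySmall V, Π sup : P_U V ≃ V, Π A : U, tupling V sup A)
  (λ V : TYPE, λ s : locallySmall V, λ sup : P_U V ≃ V, λ A : U, λ f : A ⇒ V,
    let I := imageOf A V s f in
    let incl := con cIncl · A · V · s · f in
    let x := pair U (fun A => A ↪ V) I
               (pair (I ⇒ V) (isEmb I V) incl (con cInclIsEmb · A · V · s · f)) in
    let Q z := ∃ a : A, f · a =[V] z in
    (* The family on [P_U V] whose composite with the inverse of [sup] is [mem V sup z]. *)
    let member z :=
      con cSigInd · U · (λ A : U, A ↪ V) · (λ _ : P_U V, TYPE)
        · (λ A : U, λ f : A ↪ V, Σ a : A, pr1 (A ⇒ V) (isEmb A V) f · a =[V] z) in
    pair V (fun w => Π z : V, mem V sup z w ≃ Q z)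
      (pr1 (P_U V ⇒ V) (isEquiv (P_U V) V) sup · x)
      (λ z : V,
         let P := fiber I V incl z in
         inv_equiv · P_U V · V · sup · member z · (mem_fun · V · sup · z)
           · (λ y : V, refl TYPE (mem V sup z y))
           (* Reflexivity suffices since [member z · x] computes to the fibre [P]. *)
           · x · P · refl TYPE P · Q z · (fiber_incl_equiv · A · V · s · f · z))).

Definition finite_tupling : expr :=
  λ V : TYPE, λ s : locallySmall V, λ sup : P_U V ≃ V, λ A : TYPE, λ h : isFinite A,
    sigInd U (fun B => A ≃ B) (fun _ => tupling V sup A)
      (fun B e => transport_Equiv · (λ X : TYPE, tupling V sup X) · A · B · e
         · (tupling_small · V · s · sup · B))
      (essentiallySmall_of_isFinite · A · h).

Theorem mainTheorem8 :
  HoTT_with_images_proves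
    (Π V : TYPE, locallySmall V ⇒
     (Π sup : P_U V ≃ V,
        hasFinitePropositionalTupling V (mem V sup))).
Proof.
  (* The fuel 1000 bounds the recursion depth of the checker. *)
  apply (proves_of_check 1000 finite_tupling).
  vm_cast_no_check (eq_refl true).
Qed.
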